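(* Let $n\ge 3$. There exists a lattice tiling of $\mathbb{Z}^n$ by $\mathcal{B}(n,2,3,0)$ if and only if $n=3$.
   Context: For integers $n\ge t\ge 1$ and $k_1\ge k_2\ge 0$, the limited-magnitude error ball is $\mathcal{B}(n,t,k_1,k_2)=\{\mathbf{a}=(a_1,\dots,a_n)\in\mathbb{Z}^n : a_i\in[-k_2,k_1] \text{ for all } i,\ \mathrm{wt}(\mathbf{a})\le t\}$, where $\mathrm{wt}(\mathbf{a})$ is the Hamming weight (number of nonzero coordinates). A set $C\subset\mathbb{Z}^n$ gives a tiling of $\mathbb{Z}^n$ by $\mathcal{B}$ if the translates $\mathcal{B}+c$, $c\in C$, partition $\mathbb{Z}^n$; it is a lattice tiling if moreover $C$ is a lattice (an additive subgroup of $\mathbb{Z}^n$). *)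

(* Defs.v *)
From HB Require Import structures.
From mathcomp Require Import all_boot all_order all_algebra.
From mathcomp Require Import boolp classical_sets.

Set Implicit Arguments.
Unset Strict Implicit.
Unset Printing Implicit Defensive.

Import Order.TTheory GRing.Theory Num.Theory.

Local Open Scope classical_set_scope.
Local Open Scope ring_scope.

Definition wt (n : nat) (a : 'rV[int]_n) : nat := #|[pred i | a 0 i != 0]|.

Definition error_ball (n t k1 k2 : nat) : set 'rV[int]_n :=
  [set a : 'rV[int]_n | (forall i, - k2%:Z <= a 0 i <= k1%:Z) /\ (wt a <= t)%N].

Arguments error_ball n t k1 k2 : clear implicits.

Definition translate (n : nat) (B : set 'rV[int]_n) (c : 'rV[int]_n) :
  set 'rV[int]_n := [set b + c | b in B].

(* The translates are indexed by C, so distinct elements of C must give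
   disjoint translates. *)
Definition tiling (n : nat) (B C : set 'rV[int]_n) : Prop :=
  partition C (translate B) setT.

(* Any additive subgroup counts as a lattice, with no condition on its rank. *)
Definition lattice (n : nat) (C : set 'rV[int]_n) : Prop :=
  zmod_closed [in C].

Definition lattice_tiling (n : nat) (B C : set 'rV[int]_n) : Prop :=
  lattice C /\ tiling B C.

(* Main.v *)
Require Import Defs.
From HB Require Import structures.
From mathcomp Require Import all_boot all_order all_algebra all_fingroup all_solvable.
From mathcomp Require Import zify ring.

(**
A lattice tiling amounts to a finite abelian group G with elements s_1, ..., s_n
such that every element of G is a s_i + b s_j (0 <= a, b <= 3) in exactly one way;
in particular 2|G| = 9n^2 - 3n + 2, so 3 and 5 do not divide |G|.

Let D consist of 0 and the a s_i (1 <= a <= 3). There are 2(|G| - 1) differences of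
elements of D lying on different axes, and none of them is 0, so at least |G| - 1 of
them have to be discarded to leave distinct ones. By uniqueness of representations a
coincidence x - y = x' - y' is only possible if x and y' (or x' and y) lie on a common
axis, i.e. comes from a relation k s_i = x' + y with 4 <= k <= 6. There are O(n) of
these, except those of the form 4 s_i = 4 s_j; hence all but at most four of the
elements 4 s_i coincide.

If n >= 6 this yields many elements of order dividing 4. On the other hand |G| is then
even, and counting the ball along a character of order 2 shows 3n - 2 = r^2, so that
2|G| = (r^2 + r + 2)(r^2 - r + 2), whose 2-part is too small. The case n = 5 is excluded
since |G| = 106 is even but 13 is not a square, and n = 4 by a search in Z/67. For n = 3
the elements 1, 10, 26 of Z/37 give a tiling.
*)

Set Implicit Arguments.
Unset Strict Implicit.
Unset Printing Implicit Defensive.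

Import Order.TTheory GRing.Theory Num.Theory.
Local Open Scope ring_scope.

(** * Unique representations in an abelian group *)

Section Points.
Variables (V : zmodType) (n : nat) (s : 'I_n -> V).

Definition axis_pt := option ('I_n * 'I_3).

Definition pt (x : axis_pt) : V := if x is Some (i, a) then s i *+ a.+1 else 0.
Definition axis (x : axis_pt) : option 'I_n := omap fst x.
(** [None] is independent of every point, itself included, so that 0 and the single multiples also
    have representations. *)
Definition indep (x y : axis_pt) := (x == None) || (axis x != axis y).

Definition packs := forall x y x' y' : axis_pt, indep x y -> indep x' y' ->
  pt x + pt y = pt x' + pt y' -> (x, y) = (x', y') \/ (x, y) = (y', x').
Definition covers := forall g : V, exists x y : axis_pt, indep x y /\ g = pt x + pt y.

Lemma indep_sym x y : indep x y = indep y x.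
Proof. by case: x y => [[i a]|] [[j b]|] //; rewrite /indep /= eq_sym. Qed.

End Points.

(** * Group order and sums of characters *)

Section Counting.
Variables (G : finZmodType) (n : nat) (s : 'I_n -> G).
Hypotheses (pk : packs s) (cv : covers s).
Notation pt := (pt s).

Definition reps (g : G) : {set axis_pt n * axis_pt n} :=
  [set p | indep p.1 p.2 & pt p.1 + pt p.2 == g].

(** Pairs are ordered: a nonzero [g] has its representation and the swapped one, while 0 has only
    [(None, None)], its own swap. *)
Lemma card_reps g : (#|reps g| + (g == 0%R) = 2)%N.
Proof.
have [x [y [xy ->]]] := cv g.
have -> : reps (pt x + pt y) = [set (x, y); (y, x)].
  apply/setP=> -[x' y']; rewrite !inE /=; apply/andP/orP => [[xy' /eqP e]|].
    by case: (pk xy' xy e) => ->; rewrite eqxx; [left|right].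
  by case=> /eqP[-> ->]; [|rewrite indep_sym addrC].
have e0 : (pt x + pt y == 0) = (x == None) && (y == None).
  apply/eqP/andP => [e|[/eqP-> /eqP->]]; last by rewrite addr0.
  by case: (@pk x y None None xy isT) => [|[-> ->]|[-> ->]] //; rewrite e addr0.
rewrite cards2 e0 xpair_eqE [y == x]eq_sym andbb.
case: (x =P y) => [exy|nxy].
  by move: xy; rewrite exy /indep eqxx orbF => ->.
by case: eqP nxy => [->|//]; case: eqP => [->|//].
Qed.

Lemma sum_indep (F : G -> int) :
  (\sum_g F g) *+ 2 = F 0 + \sum_(p : axis_pt n * axis_pt n | indep p.1 p.2) F (pt p.1 + pt p.2).
Proof.
rewrite (partition_big (fun p => pt p.1 + pt p.2) predT) //=.
transitivity (\sum_g (F g *+ (g == 0%R) + F g *+ #|reps g|)).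
  by rewrite -sumrMnl; apply: eq_bigr => g _; rewrite -mulrnDr addnC card_reps.
rewrite big_split /=; congr (_ + _).
  by rewrite (bigD1 (0 : G)) //= eqxx big1 ?addr0 // => g /negPf->.
apply: eq_bigr => g _; rewrite -sumr_const; apply: eq_big => [p|p].
  by rewrite inE.
by rewrite inE => /andP[_ /eqP->].
Qed.

Section Multiplicative.
Variable F : G -> int.
Hypotheses (F0 : F 0 = 1) (FD : forall x y, F (x + y) = F x * F y).

Let e i := F (s i) + F (s i) ^+ 2 + F (s i) ^+ 3.

Lemma F_mulrn x k : F (x *+ k) = F x ^+ k.
Proof. by elim: k => [|k IH]; rewrite ?mulr0n // mulrS FD IH exprS. Qed.

(** Over all ordered pairs of axis points the sum factors as a square; the dependent pairs have both
    points on one axis, and axis [i] contributes [e i ^+ 2]. *)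
Lemma sum_multiplicative :
  (\sum_g F g) *+ 2 = 1 + (1 + \sum_i e i) ^+ 2 - \sum_i (e i) ^+ 2.
Proof.
have eE i : \sum_(a < 3) F (pt (Some (i, a))) = e i.
  by rewrite !big_ord_recl big_ord0 /= !F_mulrn /e addr0 !addrA.
have sumX (f : axis_pt n -> int) : \sum_x f x = f None + \sum_i \sum_(a < 3) f (Some (i, a)).
  rewrite (bigD1 None) //=; congr (_ + _).
  rewrite pair_big /= (reindex_omap Some id) /=; last by case.
  by apply: eq_big => [[i a]|[i a]] //; rewrite eqxx.
have -> : (1 + \sum_i e i) ^+ 2 = \sum_(p : axis_pt n * axis_pt n) F (pt p.1 + pt p.2).
  rewrite -(pair_bigA _ (fun x y => F (pt x + pt y))) /=.
  have -> : 1 + \sum_i e i = \sum_x F (pt x).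
    by rewrite sumX /= F0; congr (_ + _); apply: eq_bigr => i _; rewrite eE.
  rewrite expr2 mulr_suml; apply: eq_bigr => x _; rewrite mulr_sumr.
  by apply: eq_bigr => y _; rewrite FD.
rewrite sum_indep F0 -addrA; congr (_ + _); rewrite [in RHS](bigID (fun p => indep p.1 p.2)) /=.
rewrite -[LHS]addr0 -addrA; congr (_ + _); apply/esym/eqP; rewrite subr_eq0; apply/eqP.
rewrite -(pair_big_dep predT (fun x y => ~~ indep x y) (fun x y => F (pt x + pt y))) /=.
rewrite sumX /= big_pred0 ?add0r; last by [].
apply: eq_bigr => i _; rewrite expr2 -{1}eE mulr_suml; apply: eq_bigr => a _.
rewrite big_mkcond sumX /= add0r (bigD1 i) //= addrC big1 ?add0r => [|j ji]; last first.
  by apply: big1 => b _; rewrite /indep /= eq_sym (inj_eq Some_inj) ji.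
by rewrite -eE mulr_sumr; apply: eq_bigr => b _; rewrite /indep /= eqxx FD.
Qed.

End Multiplicative.

(** The constant function 1 gives [e i = 3] on every axis. *)
Lemma card_group : (2 * #|G| + 3 * n = 9 * n ^ 2 + 2)%N.
Proof.
have := @sum_multiplicative (fun=> 1) erefl (fun _ _ => esym (mulr1 _)).
rewrite !sumr_const card_ord !expr1n -[1 + 1]/(2%:Z) -[2%:Z + 1]/(3%:Z).
have mz (x : int) k : x *+ k = x * k%:Z by rewrite pmulrn mulrzz.
move: #|_| => g; rewrite (mz _ 2) (mz 3%:Z) (mz (_ ^+ 2)) natz expr2 => h; nia.
Qed.

End Counting.

(** * Torsion and quadratic characters *)

Lemma order_dvd (G : finZmodType) (x : G) k : (#[x]%g %| k)%N = (x *+ k == 0).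
Proof. by rewrite order_dvdn FinRing.zmodXgE FinRing.zmod1gE. Qed.

Lemma order_card (G : finZmodType) (x : G) : (#[x]%g %| #|G|)%N.
Proof. by rewrite -cardsT; apply: order_dvdG; rewrite inE. Qed.

Lemma mulrn_coprime_eq0 (G : finZmodType) (x : G) k :
  coprime k #|G| -> x *+ k = 0 -> x = 0.
Proof.
move=> co /eqP; rewrite -order_dvd => d.
have : (#[x]%g %| gcdn k #|G|)%N by rewrite dvdn_gcd d order_card.
by rewrite (eqP co) order_dvd mulr1n => /eqP.
Qed.

Lemma cauchy_zmod (G : finZmodType) p : prime p -> (p %| #|G|)%N ->
  exists2 x : G, x != 0 & x *+ p = 0.
Proof.
move=> pp; rewrite -cardsT => /(Cauchy pp)[x _ ox]; exists x; last first.
  by apply/eqP; rewrite -order_dvd ox.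
by apply/eqP => x0; have := order_dvd x 1; rewrite mulr1n x0 eqxx -x0 ox dvdn1;
  case: eqP pp => // ->.
Qed.

(** A proper subgroup [M] containing all doubles, of maximal size, has index 2; [F] is 1 on [M] and
    -1 off it. *)
Lemma quadratic_character (G : finZmodType) : (2 %| #|G|)%N ->
  exists F : G -> int, [/\ forall x y, F (x + y) = F x * F y,
    forall x, F x = 1 \/ F x = -1 & \sum_x F x = 0].
Proof.
move=> g2.
pose P (M : {set G}) := [&& M != [set: G], [forall x in M, forall y in M, x - y \in M]
  & [forall x, x *+ 2 \in M]].
(* The doubles form a proper subgroup: an element of order 2 keeps doubling from being injective. *)
have P0 : P [set x *+ 2 | x in [set: G]].
  apply/and3P; split.
  - apply/eqP => e; have [x x0 x2] := cauchy_zmod (isT : prime 2) g2.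
    have /imset_injP inj : #|[set x *+ 2 | x in [set: G]]| == #|[set: G]| by rewrite e.
    by case/eqP: x0; apply: inj; rewrite ?inE // x2 mul0rn.
  - apply/forall_inP => _ /imsetP[x _ ->]; apply/forall_inP => _ /imsetP[y _ ->].
    by rewrite -mulrnBl; apply: imset_f.
  - by apply/forallP => x; apply: imset_f.
case: (arg_maxnP (fun M : {set G} => #|M|) P0) => M /and3P[MT /forall_inP MB /forallP M2] Mmax.
have MBB x y : x \in M -> y \in M -> x - y \in M by move=> Mx My; apply: (forall_inP (MB x Mx)).
have M0 : 0 \in M by rewrite -(mul0rn _ 2).
have MN x : x \in M -> - x \in M by move=> Mx; rewrite -sub0r MBB.
have MD x y : x \in M -> y \in M -> x + y \in M by move=> Mx My; rewrite -[y]opprK MBB ?MN.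
(* Adjoining the coset of [y] keeps the set closed because [y *+ 2] is in [M]; by maximality the
   result is all of [G], so it contains [x]. *)
have cosets x y : x \notin M -> y \notin M -> x - y \in M.
  move=> Mx My; pose M' := M :|: [set z | z - y \in M].
  have ltM : (#|M| < #|M'|)%N.
    apply: proper_card; apply/properP; split; first exact: finset.subsetUl.
    by exists y => //; rewrite !inE subrr M0 orbT.
  have : ~~ P M' by apply: contraL ltM => /Mmax; rewrite -leqNgt.
  rewrite !negb_and negbK => /or3P[/eqP e|/negP[]|/negP[]].
  - by have := in_setT x; rewrite -e !inE (negPf Mx).
  - apply/forall_inP => a; rewrite !inE => Ma; apply/forall_inP => b; rewrite !inE => Mb.
    case/orP: Ma => Ma; case/orP: Mb => Mb.
    + by rewrite MBB.
    + have -> : a - b - y = a - (b - y) - y *+ 2 by rewrite opprB [y - b]addrC addrA mulr2n opprD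
      addrA addrK.
      by rewrite (MBB (a - (b - y))) ?M2 ?orbT // MBB.
    + by rewrite [a - b - y]addrAC (MBB (a - y)) ?orbT.
    + have -> : a - b = a - y - (b - y) by rewrite opprB addrA addrNK.
      by rewrite MBB.
  - by apply/forallP => a; rewrite !inE M2.
exists (fun x => if x \in M then 1 else -1); split.
- move=> x y; case: (boolP (x \in M)) (boolP (y \in M)) => [Mx|Mx] [My|My].
  + by rewrite MD.
  + rewrite ifN ?mul1r //; apply: contra My => Mxy.
    by rewrite -[y](addKr x) addrC MBB.
  + rewrite ifN ?mulr1 //; apply: contra Mx => Mxy.
    by rewrite -[x](addrK y) MBB.
  + have -> : x + y = x - y + y *+ 2 by rewrite mulr2n addrA addrNK.
    by rewrite MD ?M2 ?cosets // mulrNN mulr1.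
- by move=> x; case: ifP; [left|right].
- have [c Mc] : exists c, c \notin M.
    by apply/existsP; apply: contraR MT => /existsPn h; apply/eqP/setP => z; rewrite inE;
      apply/negPn/h.
  (* Translation by an element outside [M] changes the sign of [F]. *)
  set S := \sum_x _; suff : S = - S by lia.
  rewrite {1}/S (reindex_inj (addIr c)) /= -sumrN; apply: eq_bigr => x _.
  case: (boolP (x \in M)) => Mx.
    rewrite ifN //; apply: contra Mc => Mxc.
    by rewrite -[c](addKr x) addrC MBB.
  have -> : x + c = x - c + c *+ 2 by rewrite mulr2n addrA addrNK.
  by rewrite MD ?M2 ?cosets ?opprK.
Qed.

(** With [F] of values 1 and -1 and sum 0, each [e i] is 3 or -1; taking [p] as the number of axes
    with value -1 turns [sum_multiplicative] into this equation. *)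
Lemma even_card (G : finZmodType) (n : nat) (s : 'I_n -> G) : packs s -> covers s ->
  (2 %| #|G|)%N -> exists p : nat, (3 * n%:Z - 4 * p%:Z) ^+ 2 = 3 * n%:Z - 2.
Proof.
move=> pk cv /quadratic_character[F [FD F1 FS]].
have F0 : F 0 = 1 by have := FD 0 0; rewrite addr0; case: (F1 0) => ->.
have := sum_multiplicative pk cv F0 FD; rewrite FS mul0rn.
exists #|[set i | F (s i) == -1]|.
pose d i : int := (F (s i) == -1)%R%:Z.
have eE i : F (s i) + F (s i) ^+ 2 + F (s i) ^+ 3 = 3 - 4 * d i.
  by rewrite /d; case: (F1 (s i)) => ->.
have e2 i : (F (s i) + F (s i) ^+ 2 + F (s i) ^+ 3) ^+ 2 = 9 - 8 * d i.
  by rewrite /d; case: (F1 (s i)) => ->.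
have Ed : \sum_i d i = #|[set i | F (s i) == -1]|%:Z.
  rewrite /d -sum1_card -natz natr_sum big_mkcond [RHS]big_mkcond; apply: eq_bigr => i _.
  by rewrite inE; case: eqP.
have cst (k : int) : \sum_(i < n) k = k * n%:Z by rewrite sumr_const card_ord pmulrn mulrzz.
move: H; rewrite (eq_bigr _ (fun i _ => eE i)) (eq_bigr _ (fun i _ => e2 i)).
rewrite !sumrB !cst -!mulr_sumr Ed; move: #|_| => p. rewrite !expr2; nia.
Qed.

(** * Coincidences among differences *)

Section Differences.
Variables (G : finZmodType) (n : nat) (s : 'I_n -> G).
Hypotheses (pk : packs s) (cv : covers s).
Notation pt := (pt s).

Lemma pt_Some (i : 'I_n) k (lk : (k < 3)%N) : pt (Some (i, Ordinal lk)) = s i *+ k.+1.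
Proof. by []. Qed.

Lemma pt_inj : injective pt.
Proof.
move=> x y e; case: (@pk x None y None); rewrite ?e /indep ?orbT //.
- by case: x {e} => [[i a]|].
- by case: y {e} => [[i a]|].
- by case.
- by case=> -> ->.
Qed.

(* The restrictions on [j] select one end of each coincidence [k s_i = m s_j],
   so that it is not counted twice. *)
Definition allowed (i : 'I_n) (k : nat) (q : axis_pt n * axis_pt n) : bool :=
  match q with
  | (Some (j, c), Some (l, d)) =>
    (j == l) ==> [&& 3 < k & [|| c + d < 2, k < c + d + 2 | (k == c + d + 2) && (i < j)]]%N
  | _ => true
  end.

Definition sol (i : 'I_n) (k : nat) : {set axis_pt n * axis_pt n} :=
  [set q | [&& axis q.1 != Some i, axis q.2 != Some i,
               pt q.1 + pt q.2 == s i *+ k & allowed i k q]].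

Lemma solI i k x y : axis x != Some i -> axis y != Some i ->
  pt x + pt y = s i *+ k -> allowed i k (x, y) -> (x, y) \in sol i k.
Proof. by move=> xi yi e al; rewrite inE; apply/and4P; split=> //; apply/eqP. Qed.

Definition diffs : {set axis_pt n * axis_pt n} := [set p | axis p.1 != axis p.2].

(** If [x + y = (a + 1) s_i + (b + 1) s_i], the differences [(a + 1) s_i - y] and [x - (b + 1) s_i]
    coincide; the first of the two is discarded. *)
Definition removed : {set axis_pt n * axis_pt n} :=
  [set (Some (t.1.1, t.1.2.1), t.2.2) | t : ('I_n * ('I_3 * 'I_3)) * (axis_pt n * axis_pt n)
     & t.2 \in sol t.1.1 (t.1.2.1 + t.1.2.2 + 2)%N].

Lemma removedI i (a b : 'I_3) x y : (x, y) \in sol i (a + b + 2)%N ->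
  (Some (i, a), y) \in removed.
Proof. by move=> h; apply/imsetP; exists ((i, (a, b)), (x, y)) => //; rewrite in_set. Qed.

Lemma indep_allowed i k x y : indep x y -> allowed i k (x, y).
Proof.
case: x y => [[j c]|] [[l d]|] //=; rewrite /indep /=.
by rewrite (inj_eq Some_inj) => /negPf->.
Qed.

Lemma not_indep (x y : axis_pt n) : ~~ indep x y ->
  exists i a b, x = Some (i, a) /\ y = Some (i, b).
Proof.
case: x y => [[i a]|] [[j b]|] //=; rewrite /indep /= ?negbK ?orbF //.
by move/eqP=> [->]; exists j, a, b.
Qed.

Lemma pt_addSS (i : 'I_n) (a b : 'I_3) : pt (Some (i, a)) + pt (Some (i, b)) = s i *+ (a + b +
  2)%N.
Proof. by rewrite /= -mulrnDr; congr (_ *+ _); lia. Qed.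

Lemma mulr_small_inj (i j : 'I_n) k m : (0 < k <= 3)%N -> (0 < m <= 3)%N ->
  s i *+ k = s j *+ m -> i = j /\ k = m.
Proof.
case: k m => [|k] [|m] // hk hm.
by rewrite -(pt_Some i hk) -(pt_Some j hm) => /pt_inj[-> ->].
Qed.

(** Rewrite the coincidence as [x + y' = x' + y]. If both sums are independent, packing forces
    equality; otherwise one of them is a multiple of a single [s_i], and the other solves the
    equation behind [removed]. *)
Lemma collision p p' : p \in diffs -> p' \in diffs -> pt p.1 - pt p.2 = pt p'.1 - pt p'.2 ->
  [|| p == p', p \in removed | p' \in removed].
Proof.
case: p p' => [x y] [x' y']; rewrite !inE /= => xy xy' e.
have {}e : pt x + pt y' = pt x' + pt y.
  by rewrite -[pt x](subrK (pt y)) e addrAC subrK.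
case: (boolP (indep x y')) => [ixy'|/not_indep[i [a [b [ex ey']]]]].
  case: (boolP (indep x' y)) => [ix'y|/not_indep[j [c [d [ex' ey]]]]].
    case: (pk ixy' ix'y e) => [[-> ->]|[exy]]; first by rewrite eqxx.
    by rewrite exy eqxx in xy.
  subst x' y; apply/or3P/Or33; apply: (@removedI j c d x).
  by apply: solI; rewrite ?indep_allowed // ?e ?pt_addSS // eq_sym.
subst x y'.
have aiy : axis y != Some i by rewrite eq_sym.
have ax'i : axis x' != Some i by [].
case: (boolP (allowed i (a + b + 2)%N (x', y))) => al.
  by apply/or3P/Or32; apply: (@removedI i a b x'); apply: solI; rewrite // -e pt_addSS.
case: (boolP (indep x' y)) => [ix'y|/not_indep[j [c [d [ex' ey]]]]].
  by rewrite indep_allowed in al.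
subst x' y; apply/or3P/Or33; apply: (@removedI j c d (Some (i, a))).
have nij : i != j by rewrite eq_sym -(inj_eq Some_inj).
apply: solI; rewrite ?e ?pt_addSS ?(inj_eq Some_inj) //=.
move: al; rewrite /= !eqxx /= => al.
(* Two equal multiples that are both at most 3 would be the same point of D. So one multiple exceeds
   3, and if the end on axis [i] is rejected, the end on axis [j] is allowed. *)
have h : ~~ ((a + b + 2 <= 3) && (c + d + 2 <= 3))%N.
  apply/negP => /andP[h1 h2]; move: e; rewrite !pt_addSS.
  by case/mulr_small_inj => [||/eqP]; rewrite ?h1 ?h2 ?(negPf nij) //; lia.
have nij' : (i : nat) <> j by move=> /val_inj; apply/eqP.
lia.
Qed.

(** There are [2|G| - 2] elements in [diffs]; those not removed have distinct nonzero differences,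
    so at most [|G| - 1] survive. *)
Lemma card_removed_ge : (#|G| <= #|removed| + 1)%N.
Proof.
have cD : (#|diffs| + 2 = 2 * #|G|)%N.
  have := sum_indep pk cv (fun=> 1); rewrite !sumr_const -[#|_|]/#|G|.
  rewrite (_ : #|_| = #|diffs|.+1) => [|]; last first.
    rewrite (cardD1 (None, None)) unfold_in /= /indep /= add1n; congr _.+1.
    by apply: eq_card => -[[[i a]|] [[j b]|]]; rewrite !inE /=.
  move: #|diffs| #|_| => d g h; lia.
pose f (p : axis_pt n * axis_pt n) := pt p.1 - pt p.2.
have inj : {in diffs :\: removed &, injective f}.
  move=> p p' /setDP[pD /negPf pR] /setDP[p'D /negPf p'R] e.
  by have := collision pD p'D e; rewrite pR p'R !orbF => /eqP.
have : (#|f @: (diffs :\: removed)| <= #|[set~ (0%R : G)]|)%N.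
  apply/subset_leq_card/subsetP => _ /imsetP[[x y] /setDP[xy _] ->].
  by move: xy; rewrite !inE /= subr_eq0; apply: contra => /eqP/pt_inj /= ->.
rewrite (card_in_imset inj).
rewrite cardsC1; have := cardsID removed diffs; have := subset_leq_card (subsetIr diffs removed).
move: cD; move: #|diffs| #|diffs :&: _| #|diffs :\: _| #|removed| #|G|; lia.
Qed.

(** The multiples k = 2, 3, 4, 5, 6 enter with multiplicity 1, 2, 3, 2, 1, the number of ways to
    write k as an ordered sum of two coefficients. *)
Definition weight i := (\sum_(a < 3) \sum_(b < 3) #|sol i (a + b + 2)%N|)%N.

Lemma card_removed_le : (#|removed| <= \sum_i weight i)%N.
Proof.
apply: leq_trans (leq_imset_card _ _) _.
rewrite -sum1_card.
rewrite (eq_bigl (fun t : ('I_n * ('I_3 * 'I_3)) * (axis_pt n * axis_pt n) => predT t.1 && (t.2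
  \in sol t.1.1 (t.1.2.1 + t.1.2.2 + 2)%N))); last by move=> t; rewrite inE.
rewrite -(pair_big_dep predT (fun (u : 'I_n * ('I_3 * 'I_3)) q => q \in sol u.1 (u.2.1 + u.2.2 +
  2)%N) (fun _ _ => 1%N)) /=.
rewrite -(pair_bigA _ (fun i (ab : 'I_3 * 'I_3) => \sum_(q in sol i (ab.1 + ab.2 + 2)) 1)%N) /=.
apply/eq_leq/eq_bigr => i _; rewrite /weight pair_bigA /=; apply: eq_bigr => ab _.
by rewrite sum1_card.
Qed.

End Differences.

Lemma card_swap_le (T : finType) (S : {set T * T}) :
  (forall p q, p \in S -> q \in S -> q = p \/ q = (p.2, p.1)) -> (#|S| <= 2)%N.
Proof.
move=> h; have [->|[p pS]] := set_0Vmem S; first by rewrite cards0.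
apply: leq_trans (_ : #|[set p; (p.2, p.1)]| <= 2)%N; last by rewrite cards2; case: (_ != _).
by apply/subset_leq_card/subsetP => q /(h _ _ pS) [] ->; rewrite !inE eqxx ?orbT.
Qed.

(** * Bounding the coincidences on one axis *)

Section Weights.
Variables (G : finZmodType) (n : nat) (s : 'I_n -> G).
Hypotheses (pk : packs s) (cv : covers s).
Notation pt := (pt s).
Notation sol := (sol s).

(** The value [9 n ^ 2 - 3 n + 2] of [2|G|] is 2 modulo 3, and for n = 0, ..., 4 modulo 5 it is 2,
    3, 2, 4, 4. *)
Lemma coprime_card : coprime 3 #|G| /\ coprime 5 #|G|.
Proof.
have := card_group pk cv; move: #|_| => g h.
rewrite !prime_coprime //; split; apply/negP => /dvdnP[k gk]; subst g; first lia.
have : (n %% 5 < 5)%N by rewrite ltn_mod.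
move: (divn_eq n 5) h; move: (n %/ 5)%N (n %% 5)%N => q r -> h r5.
have {r5} : [|| r == 0, r == 1, r == 2, r == 3 | r == 4]%N by lia.
by case/or4P => [||| /orP[]] /eqP ?; subst r; lia.
Qed.

Lemma mulr5_inj (i j : 'I_n) : s i *+ 5 = s j *+ 5 -> i = j.
Proof.
move=> e; apply: (mulr_small_inj pk (k := 1) (m := 1) isT isT _).1.
apply/eqP; rewrite -subr_eq0; apply/eqP/(mulrn_coprime_eq0 coprime_card.2).
by rewrite mulrnBl !mulr1n e subrr.
Qed.

(** The factor 3 cancels since it is prime to the group order, and the points [2 s_i] of D are
    distinct. *)
Lemma mulr6_inj (i j : 'I_n) : s i *+ 6 = s j *+ 6 -> i = j.
Proof.
move=> e; apply: (mulr_small_inj pk (k := 2) (m := 2) isT isT _).1.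
apply/eqP; rewrite -subr_eq0; apply/eqP/(mulrn_coprime_eq0 coprime_card.1).
by rewrite mulrnBl -!mulrnA e subrr.
Qed.

Definition same_axis (m : nat) : {set axis_pt n * axis_pt n} :=
  [set q : axis_pt n * axis_pt n | match q with
           | (Some (j, c), Some (l, d)) => (j == l) && (c + d + 2 == m)%N
           | _ => false end].

Lemma same_axisP m q : q \in same_axis m -> exists j c d,
  [/\ q = (Some (j, c), Some (j, d)), (c + d + 2 = m)%N & pt q.1 + pt q.2 = s j *+ m].
Proof.
case: q => [[[j c]|] [[l d]|]]; rewrite inE //= => /andP[/eqP <- /eqP <-].
by exists j, c, d; rewrite -mulrnDr; split=> //; congr (_ *+ _); lia.
Qed.

Definition good i k := sol i k :&: [set q | indep q.1 q.2].
(** Here the sum is [2 s_j] or [3 s_j], hence itself a point of D. *)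
Definition low i k := sol i k :&: (same_axis 2 :|: same_axis 3).

Lemma solP i k q : q \in sol i k -> [/\ axis q.1 != Some i, axis q.2 != Some i,
  pt q.1 + pt q.2 = s i *+ k & allowed i k q].
Proof. by rewrite inE => /and4P[? ? /eqP]. Qed.

Lemma sol_split i k : (#|sol i k| <= #|good i k| + #|low i k| +
  (#|sol i k :&: same_axis 4| + #|sol i k :&: same_axis 5| + #|sol i k :&: same_axis 6|))%N.
Proof.
have : sol i k \subset good i k :|: low i k :|:
  (sol i k :&: same_axis 4 :|: sol i k :&: same_axis 5 :|: sol i k :&: same_axis 6).
  apply/subsetP => -[x y] h; rewrite -!finset.setIUr inE h /=.
  case: (boolP (indep x y)) => [ixy|/not_indep[j [c [d [-> ->]]]]].
    by rewrite !inE ixy.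
  rewrite !inE eqxx /=; move: (ltn_ord c) (ltn_ord d); lia.
move/subset_leq_card/leq_trans; apply.
have cU (A B : {set axis_pt n * axis_pt n}) : (#|A :|: B| <= #|A| + #|B|)%N by rewrite cardsU
  leq_subr.
by do !(apply: leq_trans (cU _ _) _; apply: leq_add => //).
Qed.

Lemma good_le2 i k : (#|good i k| <= 2)%N.
Proof.
apply: card_swap_le => -[x y] [x' y'] /setIP[/solP[_ _ e _]]; rewrite inE => ixy.
case/setIP => /solP[_ _ e' _]; rewrite inE => ixy'.
by apply: (pk ixy' ixy); rewrite /= in e e'; rewrite e e'.
Qed.

(** Up to order, 4 is the only sum of two coefficients from 1, 2, 3 with two decompositions, 1 + 3
    and 2 + 2. *)
Lemma same_axis_le2 (S : {set axis_pt n * axis_pt n}) j m : m != 4%N ->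
  (forall q, q \in S -> exists c d, q = (Some (j, c), Some (j, d)) /\ (c + d + 2 = m)%N) ->
  (#|S| <= 2)%N.
Proof.
move=> m4 h; apply: card_swap_le => p q.
move=> /h[c [d [-> e]]] /h[c' [d' [-> e']]] /=.
have : (c = c' :> nat /\ d = d' :> nat) \/ (c = d' :> nat /\ d = c' :> nat).
  by move: (ltn_ord c) (ltn_ord d) (ltn_ord c') (ltn_ord d'); lia.
by case=> -[/val_inj-> /val_inj->]; [left|right].
Qed.

Lemma sol6_le1 i k : (#|sol i k :&: same_axis 6| <= 1)%N.
Proof.
apply/card_le1_eqP => p q /setIP[/solP[_ _ ep _] /same_axisP[j [c [d [pE hm e]]]]].
move=> /setIP[/solP[_ _ eq _] /same_axisP[j' [c' [d' [qE hm' e']]]]].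
have jj' : j = j' by apply: mulr6_inj; rewrite -e -e' ep eq.
rewrite pE qE -jj'.
have -> : c = c' by apply: val_inj; move: (ltn_ord c) (ltn_ord d) (ltn_ord c') (ltn_ord d') =>
  /=; lia.
have -> // : d = d' by apply: val_inj; move: (ltn_ord c) (ltn_ord d) (ltn_ord c') (ltn_ord d') =>
  /=; lia.
Qed.

Lemma sol5_le2 i k : (#|sol i k :&: same_axis 5| <= 2)%N.
Proof.
have [->|[p]] := set_0Vmem (sol i k :&: same_axis 5); first by rewrite cards0.
case/setIP => /solP[_ _ ep _] /same_axisP[j [c [d [_ _ e]]]].
apply: (@same_axis_le2 _ j 5) => // q.
case/setIP => /solP[_ _ eq _] /same_axisP[j' [c' [d' [qE hm' e']]]].
have -> : j = j' by apply: mulr5_inj; rewrite -e -e' ep eq.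
by exists c', d'.
Qed.

Lemma low_le2 i k : (#|low i k| <= 2)%N.
Proof.
have [->|[p]] := set_0Vmem (low i k); first by rewrite cards0.
case/setIP => /solP[_ _ ep _] pm.
have [j [m [m3 em]]] : exists j m, (0 < m <= 3)%N /\ s j *+ m = s i *+ k.
  case/setUP: pm => /same_axisP[j [c [d [_ _ e]]]].
    by exists j, 2%N; rewrite -ep e.
  by exists j, 3%N; rewrite -ep e.
have m4 : m != 4%N by lia.
apply: (@same_axis_le2 _ j m) => // q.
case/setIP => /solP[_ _ eq _] /setUP[] /same_axisP[j' [c' [d' [qE hm' e']]]];
  rewrite -em e' in eq; case: (mulr_small_inj pk _ m3 eq) => // jj' mE; subst j' m;
    by exists c', d'.
Qed.

Lemma sol4_eq0 i k : (4 < k)%N -> sol i k :&: same_axis 4 = finset.set0.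
Proof.
move=> k4; apply/setP => q; rewrite in_set0; apply/negP.
case/setIP => /solP[_ _ _ al] /same_axisP[j [c [d [eq h _]]]].
by move: al; rewrite eq /= eqxx /=; lia.
Qed.

Lemma sol5_eq0 i k : (4 < k)%N -> sol i k :&: same_axis 5 = finset.set0.
Proof.
move=> k4; apply/setP => q; rewrite in_set0; apply/negP.
case/setIP => /solP[a1 _ ep al] /same_axisP[j [c [d [eq h e]]]].
have k5 : k = 5%N by move: al; rewrite eq /= eqxx /=; lia.
by move: a1; rewrite eq /= (mulr5_inj (_ : s j *+ 5 = s i *+ 5)) ?eqxx // -e ep k5.
Qed.

Lemma sol6_eq0 i : sol i 6 :&: same_axis 6 = finset.set0.
Proof.
apply/setP => q; rewrite in_set0; apply/negP.
case/setIP => /solP[a1 _ ep al] /same_axisP[j [c [d [eq h e]]]].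
by move: a1; rewrite eq /= (mulr6_inj (_ : s j *+ 6 = s i *+ 6)) ?eqxx // -e ep.
Qed.

(** The factor 3 counts the ordered splittings 1 + 3, 2 + 2, 3 + 1; [allowed] keeps only the axes
    [j] after [i]. *)
Lemma sol44_le i : (#|sol i 4 :&: same_axis 4| <= 3 * #|[set j : 'I_n | (i < j)%N & s j *+ 4 == s
  i *+ 4]|)%N.
Proof.
set U := [set j | _ & _].
pose f (t : 'I_n * 'I_3) : axis_pt n * axis_pt n := (Some (t.1, t.2), Some (t.1, inord (2 -
  t.2))).
have -> : (3 * #|U| = #|finset.setX U [set: 'I_3]|)%N by rewrite cardsX cardsT card_ord mulnC.
apply: leq_trans (leq_imset_card f _); apply/subset_leq_card/subsetP => q.
case/setIP => /solP[_ _ ep al] /same_axisP[j [c [d [eq h e]]]].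
apply/imsetP; exists (j, c).
  rewrite !inE -e ep eqxx !andbT.
  by move: al; rewrite eq /= eqxx /=; lia.
rewrite eq /f /=; congr (_, Some (_, _)); apply: val_inj => /=.
by rewrite inordK; move: (ltn_ord c); lia.
Qed.

(** The multiple [k s_i] is a point of D, so an independent representation must be [k s_i + 0],
    which uses axis [i]; [allowed] rules out the dependent ones. *)
Lemma sol_small i k : (0 < k <= 3)%N -> sol i k = finset.set0.
Proof.
case: k => // k hk; apply/setP => -[x y]; rewrite in_set0; apply/negP.
case/solP => /= ax ay e al.
case: (boolP (indep x y)) => [ixy|/not_indep[j [c [d [ex ey]]]]]; last first.
  by subst x y; move: al; rewrite eqxx /=; lia.
have := @pk _ _ (Some (i, Ordinal hk)) None ixy isT.
by rewrite /= addr0 e => /(_ erefl) [] [ex ey]; subst x y; rewrite eqxx in ax ay.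
Qed.

(* If [m s_j = k s_i] is a ball element then [(k + r) s_i = r s_i + m s_j] is the
   only representation of [(k + r) s_i], and it uses axis [i]. *)
Lemma low_eq0 i k r : low i k != finset.set0 -> (0 < r <= 3)%N ->
  good i (k + r) = finset.set0 /\ low i (k + r) = finset.set0.
Proof.
case/set0Pn => p /setIP[/solP[pi _ ep _] pm].
have [j [m [ji m3 em]]] : exists j m, [/\ j != i, (0 < m <= 3)%N & s j *+ m = s i *+ k].
  case/setUP: pm => /same_axisP[j [c [d [epp _ e]]]].
    by exists j, 2%N; split; rewrite -?ep ?e //; rewrite epp in pi.
  by exists j, 3%N; split; rewrite -?ep ?e //; rewrite epp in pi.
case: m m3 em => // m m3 em; case: r => // r r3.
have e : pt (Some (i, Ordinal r3)) + pt (Some (j, Ordinal m3)) = s i *+ (k + r.+1).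
  by rewrite /= em -mulrnDr addnC.
have ij : indep (Some (i, Ordinal r3)) (Some (j, Ordinal m3)).
  by rewrite /indep /= (inj_eq Some_inj) eq_sym.
split; apply/setP => -[x y]; rewrite in_set0; apply/negP.
  case/setIP => /solP[ax ay exy _]; rewrite inE => ixy.
  case: (pk ixy ij); rewrite ?e //= => -[ex ey]; subst x y; by rewrite eqxx in ax ay.
case/setIP => /solP[_ _ exy _] pm'.
have [l [m' [m'3 em']]] : exists l m', (0 < m' <= 3)%N /\ s l *+ m' = s i *+ (k + r.+1).
  case/setUP: pm' => /same_axisP[l [c [d [_ _ el]]]].
    by exists l, 2%N; rewrite -exy el.
  by exists l, 3%N; rewrite -exy el.
case: m' m'3 em' => // m' m'3 em'.
by case: (@pk (Some (l, Ordinal m'3)) None _ _ isT ij); rewrite // e /= addr0.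
Qed.

Lemma weight_le i : (weight s i <= 25 + 9 * #|[set j : 'I_n | (i < j)%N & s j *+ 4 == s i *+
  4]|)%N.
Proof.
have -> : weight s i = (#|sol i 2| + (#|sol i 3| + (#|sol i 4| + 0)) +
    ((#|sol i 3| + (#|sol i 4| + (#|sol i 5| + 0))) +
     ((#|sol i 4| + (#|sol i 5| + (#|sol i 6| + 0))) + 0)))%N.
  by rewrite /weight !big_ord_recl !big_ord0.
rewrite (sol_small i (k := 2)) // (sol_small i (k := 3)) // !finset.cards0.
have := sol_split i 4; have := sol_split i 5; have := sol_split i 6.
rewrite !(sol4_eq0 i (k := 5)) // !(sol4_eq0 i (k := 6)) // !(sol5_eq0 i (k :=
  5)) // !(sol5_eq0 i (k := 6)) // sol6_eq0 !finset.cards0.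
have := sol44_le i; have := sol5_le2 i 4; have := sol6_le1 i 4; have := sol6_le1 i 5.
have := good_le2 i 4; have := good_le2 i 5; have := good_le2 i 6.
have := low_le2 i 4; have := low_le2 i 5; have := low_le2 i 6.
(* The weight is three times the count for k = 4, twice that for k = 5, plus that for k = 6. With
   [u] the cardinal in the statement, the bounds are [25 + 9 u] if both [low] sets are empty,
   [25 + 9 u] if only that for k = 5 is nonempty, and [23 + 9 u] if that for k = 4 is nonempty. *)
case: (eqVneq (low i 4) finset.set0) => [->|l4].
  case: (eqVneq (low i 5) finset.set0) => [->|l5].
    rewrite !finset.cards0.
 lia.
  have [-> ->] := low_eq0 l5 (isT : (0 < 1 <= 3)%N).
  rewrite !finset.cards0; lia.
have [-> ->] := low_eq0 l4 (isT : (0 < 1 <= 3)%N).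
have [-> ->] := low_eq0 l4 (isT : (0 < 2 <= 3)%N).
rewrite !finset.cards0; lia.
Qed.

End Weights.

(** * The 2-part of the group order *)

Lemma sum_upper_triangle n (e : rel 'I_n) : reflexive e -> symmetric e ->
  (2 * (\sum_(i < n) #|[set j : 'I_n | (i < j)%N & e i j]|) + n =
   \sum_(i < n) #|[set j | e i j]|)%N.
Proof.
move=> er es.
have E i : (#|[set j | e i j]| = #|[set j : 'I_n | (i < j)%N & e i j]| +
    #|[set j : 'I_n | (j < i)%N & e j i]| + 1)%N.
  rewrite -(cardsID [set j : 'I_n | (i < j)%N] [set j | e i j]) -addnA; congr addn.
    by apply: eq_card => j; rewrite !inE andbC.
  rewrite (cardsD1 i) !inE ltnn er addnC; congr addn.
  by apply: eq_card => j; rewrite !inE -leqNgt (es j i) ltn_neqAle andbA.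
have X : (\sum_(i < n) #|[set j : 'I_n | (j < i)%N & e j i]| = \sum_(i < n) #|[set j : 'I_n | (i
  < j)%N & e i j]|)%N.
  transitivity (\sum_(i < n) \sum_(j < n | (j < i)%N && e j i) 1)%N.
    by apply: eq_bigr => i _; rewrite sum1dep_card.
  rewrite (exchange_big_dep predT) //=; by apply: eq_bigr => j _; rewrite sum1dep_card.
rewrite (eq_bigr _ (fun i _ => E i)) !big_split /= X sum1_card card_ord.
by rewrite mul2n -addnn.
Qed.

(** * Most of the elements [4 s_j] coincide *)

Section BigClass.
Variables (G : finZmodType) (n : nat) (s : 'I_n -> G).
Hypotheses (pk : packs s) (cv : covers s).

(** If every class had at most n - 5 members, the weights would give [2|G| <= 50 n + 9 n (n - 6) + 2
    = 9 n ^ 2 - 4 n + 2], below the true value by n. *)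
Lemma exists_big_class : (0 < n)%N ->
  exists i, (n <= #|[set j | s j *+ 4 == s i *+ 4]| + 4)%N.
Proof.
move=> n0; apply/existsP; apply: contraT => /existsPn small.
have := card_group pk cv; have := card_removed_ge pk cv; have := card_removed_le s.
have : (\sum_i weight s i <= \sum_(i < n) (25 + 9 * #|[set j : 'I_n | (i < j)%N & s j *+ 4 == s i
  *+ 4]|))%N.
  by apply: leq_sum => i _; apply: weight_le.
rewrite big_split /= sum_nat_const card_ord -big_distrr /=.
have := @sum_upper_triangle n (fun i j => s j *+ 4 == s i *+ 4) (fun i => eqxx _) (fun i j =>
  eq_sym _ _).
have : (\sum_(i < n) #|[set j | s j *+ 4 == s i *+ 4]| <= \sum_(i < n) (n - 5))%N.
  by apply: leq_sum => i _; have := small i; lia.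
rewrite sum_nat_const card_ord.
have n5 : (5 <= n)%N by have := small (Ordinal n0); lia.
move: (\sum_i _)%N (\sum_i _)%N (\sum_i _)%N #|removed s| #|G|; nia.
Qed.

End BigClass.

(** By Cauchy, 2 is the only prime that can divide the order of this kernel. *)
Lemma card_torsion (G : finZmodType) a : exists k,
  (#|[set x : G | x *+ (2 ^ a) == 0%R]| = 2 ^ k)%N /\ (2 ^ k %| #|G|)%N.
Proof.
set H := [set x : G | _].
have gH : group_set H.
  apply/group_setP; split; first by rewrite inE mul0rn.
  by move=> x y; rewrite !inE FinRing.zmodMgE mulrnDl => /eqP-> /eqP->; rewrite addr0.
have : (2.-nat #|Group gH|)%N.
  apply/pnatP => // q qp qH; have [x xH ox] := Cauchy qp qH.
  by move: xH; rewrite inE -order_dvd ox Euclid_dvdX // => /andP[/prime_nt_dvdP-> //];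
    case: eqP qp => // ->.
case/p_natP => k Hk; exists k; rewrite -Hk; split=> //.
by rewrite -cardsT; apply: (@cardSg _ [set: G]%G (Group gH)); apply: finset.subsetT.
Qed.

(** * Torsion elements from a class of equal [4 s_j] *)

Section Torsion.
Variables (G : finZmodType) (n : nat) (s : 'I_n -> G).
Hypotheses (pk : packs s) (cv : covers s).
Variable i : 'I_n.
Let z := s i *+ 4.
Let U := [set j | s j *+ 4 == z].
Let T : {set 'I_n * 'I_n} := [set t | [&& t.1 \in U, t.2 \in U & t.1 != t.2]].
Let G2 := [set x : G | x *+ 2 == 0].
Let G4 := [set x : G | x *+ 4 == 0].

Lemma card_distinct_pairs : (#|T| + #|U| = #|U| * #|U|)%N.
Proof.
rewrite -cardsX -(cardsID [set t : 'I_n * 'I_n | t.1 != t.2] (finset.setX U U)); congr addn.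
  by apply: eq_card => t; rewrite !inE andbA.
rewrite -(card_imset (mem U) (_ : injective (fun j : 'I_n => (j, j)))); last by move=> j k [].
apply: eq_card => -[j k]; rewrite !inE /= negbK; apply/imsetP/and3P => [[l lU [-> ->]]|[/eqP <-
  jU _]].
  by move: lU; rewrite !inE => lU; split.
by exists j; rewrite ?inE.
Qed.

(** Since [4 s_j = 4 s_k = z], the element [2 s_j + 2 s_k - z] is killed by 2; by packing it
    determines the pair up to order. *)
Lemma card_pairs_le_G2 : (#|T| <= 2 * #|G2|)%N.
Proof.
pose f (t : 'I_n * 'I_n) := s t.1 *+ 2 + s t.2 *+ 2 - z.
have fG2 t : t \in T -> f t \in G2.
  rewrite !inE => /and3P[/eqP e1 /eqP e2 _].
  by rewrite /f mulrnBl mulrnDl -(mulrnA (s t.1) 2 2) -(mulrnA (s t.2) 2 2) e1 e2 -mulr2n subrr.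
rewrite -sum1_card (partition_big f (mem G2)) //= mulnC -sum_nat_const.
apply: leq_sum => g _; rewrite sum1dep_card; apply: card_swap_le => -[j k] [j' k'].
rewrite !inE /= => /andP[/and3P[_ _ jk] /eqP e] /andP[/and3P[_ _ jk'] /eqP e'].
have e2 : s j' *+ 2 + s k' *+ 2 = s j *+ 2 + s k *+ 2 by apply: (addIr (- z));
  rewrite -[LHS]/(f (j', k')) e' -e.
have lt13 : (1 < 3)%N by [].
case: (@pk (Some (j', Ordinal lt13)) (Some (k', Ordinal lt13)) (Some (j, Ordinal lt13)) (Some (k,
  Ordinal lt13))) => //.
  by case=> -> ->; left.
by case=> -> ->; right.
Qed.

(** The element [s_j + 3 s_k - z] is killed by 4, and its double is [2 s_j - 2 s_k], which is
    nonzero. The unequal coefficients make it determine the ordered pair. *)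
Lemma card_pairs_le_G4 : (#|T| + #|G2| <= #|G4|)%N.
Proof.
pose f (t : 'I_n * 'I_n) := s t.1 + s t.2 *+ 3 - z.
have fG4 t : t \in T -> f t \in G4 :\: G2.
  rewrite !inE => /and3P[/eqP e1 /eqP e2 ne]; apply/andP; split.
    have e6 : s t.2 *+ 3 *+ 2 + s t.2 *+ 2 = z *+ 2 by rewrite -e2 -!mulrnA -mulrnDr.
    apply: contra ne; rewrite /f mulrnBl mulrnDl -e6 opprD addrA addrK subr_eq0 => /eqP e.
    by apply/eqP; apply: (mulr_small_inj pk (k := 2) (m := 2) isT isT e).1.
  by rewrite /f mulrnBl mulrnDl e1 -mulrnA (mulrnA _ 4 3) e2 -mulrS subrr.
have <- : #|f @: T| = #|T|.
  apply: card_in_imset => -[j k] [j' k']; rewrite !inE /= => /and3P[_ _ jk] /and3P[_ _ jk']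
    /(addIr (- z)) e.
  have lt03 : (0 < 3)%N by []. have lt23 : (2 < 3)%N by [].
  case: (@pk (Some (j, Ordinal lt03)) (Some (k, Ordinal lt23)) (Some (j', Ordinal lt03)) (Some
    (k', Ordinal lt23))) => //.
  by case=> -> ->.
have G24 : G4 :&: G2 = G2.
  by apply/setIidPr/subsetP => x; rewrite !inE => /eqP x2; rewrite (mulrnA x 2 2) x2 mul0rn.
rewrite -(cardsID G2 G4) G24 addnC leq_add2l; apply/subset_leq_card/subsetP => _ /imsetP[t tT ->].
exact: fG4.
Qed.

End Torsion.

(** If 8 divided both factors, 4 would divide [r] and [X] would be 2 modulo 4. So one factor has
    2-part at most 4, and [2 ^ (k - 1)] divides the other. *)
Lemma pow2_dvd_product k X Y r : (2 ^ k.+1 %| X * Y)%N -> (X = Y + 2 * r)%N -> (0 < Y)%N ->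
  (X = r ^ 2 + r + 2)%N -> (2 ^ k <= 2 * X)%N.
Proof.
move=> d XY Y0 Xr.
have X0 : (0 < X)%N by lia.
have : (k.+1 <= logn 2 X + logn 2 Y)%N by rewrite -lognM // -pfactor_dvdn // muln_gt0 X0.
have : ~~ ((8 %| X) && (8 %| Y))%N.
  apply/negP => /andP[/dvdnP[x xE] /dvdnP[y yE]].
  have [u ru] : exists u, (r = 4 * u)%N by exists (x - y)%N; lia.
  subst r; move: Xr; rewrite xE; nia.
rewrite -[8%N]/(2 ^ 3)%N !pfactor_dvdn //.
have lX : (2 ^ logn 2 X <= X)%N by apply: dvdn_leq => //; apply: pfactor_dvdnn.
have lY : (2 ^ logn 2 Y <= X)%N by apply: leq_trans (_ : Y <= X)%N; [apply: dvdn_leq => //;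
  apply: pfactor_dvdnn | lia].
move: (logn 2 X) (logn 2 Y) lX lY => a b lX lY hab hk.
have [ka|kb] : (k <= a + 1)%N \/ (k <= b + 1)%N by lia.
  by apply: leq_trans (_ : 2 ^ (a + 1) <= _)%N; rewrite ?leq_exp2l // addn1 expnS; lia.
by apply: leq_trans (_ : 2 ^ (b + 1) <= _)%N; rewrite ?leq_exp2l // addn1 expnS; lia.
Qed.

(** The torsion forces [2 ^ k] to grow like [m ^ 2], hence [n ^ 2], while the factorization of [2 g]
    keeps it below a multiple of [r ^ 2], which is linear in [n]. *)
Lemma torsion_bounds_absurd (n g m k l p : nat) : (6 <= n)%N -> (n <= m + 4)%N ->
  (2 * g + 3 * n = 9 * n ^ 2 + 2)%N -> (3 * n%:Z - 4 * p%:Z) ^+ 2 = 3 * n%:Z - 2 ->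
  (m * m - m <= 2 * 2 ^ l)%N -> (m * m - m + 2 ^ l <= 2 ^ k)%N -> (2 ^ k %| g)%N -> False.
Proof.
move=> n6 mn hg hp hl hk kg.
pose r := absz (3 * n%:Z - 4 * p%:Z)%R.
have rn : (3 * n = r ^ 2 + 2)%N by apply/eqP; rewrite -eqz_nat; apply/eqP; move: hp; rewrite /r;
  nia.
have rE : 3 * n%:Z - 4 * p%:Z = r%:Z \/ 3 * n%:Z - 4 * p%:Z = - r%:Z by rewrite /r; lia.
clearbody r.
pose X := (r ^ 2 + r + 2)%N; pose Y := (r ^ 2 - r + 2)%N.
have rr : (r <= r ^ 2)%N by case: (posnP r) => [->//|r0]; rewrite expnS expn1 leq_pmulr.
have XYg : (X * Y = 2 * g)%N.
  have e9 : (9 * n ^ 2 = (r ^ 2 + 2) * (r ^ 2 + 2))%N by rewrite -rn; lia.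
  move: hg rn rr; rewrite e9 /X /Y; clear; rewrite -mulnn => hg rn rr.
  have [d dE] : exists d, (r * r = r + d)%N by exists (r * r - r)%N; rewrite subnKC.
  by rewrite rn dE in hg; rewrite dE addKn; nia.
have kX : (2 ^ k <= 2 * X)%N.
  apply: (@pow2_dvd_product k X Y r); rewrite ?XYg ?expnS ?dvdn_pmul2l //; rewrite /X /Y; lia.
have r4 : (4 <= r)%N.
  rewrite leqNgt; apply/negP => r3; have : (r ^ 2 <= 3 ^ 2)%N by rewrite leq_exp2r.
  move: rn n6; clear; lia.
  
have [r6|] := leqP 6 r.
  have m10 : (r ^ 2 <= 3 * m + 10)%N by lia.
  have q6 : (6 * r <= r ^ 2)%N by rewrite expnS expn1 leq_mul2r r6 orbT.
  have m9 : (9 <= m)%N by move: q6 m10 r6; clear; lia.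
  have mm : (9 * m <= m * m)%N by rewrite leq_mul2r m9 orbT.
  move: kX hl hk q6 m10 m9 mm; rewrite /X; clear.
  by move: (m * m)%N (r ^ 2)%N (2 ^ k)%N (2 ^ l)%N; lia.
(* For r = 4, n = 6 and [18 - 4 p] cannot be 4 or -4. For r = 5, n = 9 and [g = 352 = 32 * 11], but
   the torsion requires a factor 64. *)
move=> r5; have [r4'|r5'] : r = 4%N \/ r = 5%N by lia.
  by move: rn rE; rewrite r4'; clear; lia.
have n9 : n = 9%N by move: rn; rewrite r5'; clear; lia.
have g352 : g = 352%N by move: hg; rewrite n9; clear; lia.
have m5 : (20 <= m * m - m)%N.
  have : (5 <= m)%N by move: mn; rewrite n9; clear; lia.
  by case: m {mn hl hk} => // m; rewrite mulSn addKn => m4; apply: (@leq_mul 4 5).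
have l4 : (4 <= l)%N.
  rewrite leqNgt; apply/negP => l3; have : (2 ^ l <= 2 ^ 3)%N by rewrite leq_exp2l.
  by move: hl m5; clear; move: (2 ^ l)%N; lia.
have k6 : (6 <= k)%N.
  rewrite leqNgt; apply/negP => k5; have : (2 ^ k <= 2 ^ 5)%N by rewrite leq_exp2l.
  have : (2 ^ 4 <= 2 ^ l)%N by rewrite leq_exp2l.
  by move: hk m5; clear; move: (2 ^ l)%N (2 ^ k)%N; lia.
have : (2 ^ 6 %| g)%N by apply: dvdn_trans kg; apply: dvdn_exp2l.
by rewrite g352.
Qed.

Lemma packs_covers_le4 (G : finZmodType) (n : nat) (s : 'I_n -> G) :
  packs s -> covers s -> (n <= 4)%N.
Proof.
move=> pk cv; rewrite leqNgt; apply/negP => n5.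
have cG := card_group pk cv.
have [n6|n6] := leqP 6 n; last first.
  have n5' : n = 5%N by lia.
  have /even_card : (2 %| #|G|)%N by move: cG; rewrite n5'; move: #|_| => g; lia.
  by case/(_ _ _ pk cv) => p; rewrite n5'; nia.
have n0 : (0 < n)%N by lia.
have [i iU] := exists_big_class pk cv n0.
have [l [hl _]] := card_torsion G 1; have [k [hk kg]] := card_torsion G 2.
have := card_distinct_pairs s i; have := card_pairs_le_G2 pk i; have := card_pairs_le_G4 pk i.
rewrite (hl : #|[set x : G | x *+ 2 == 0%R]| = 2 ^ l)%N (hk : #|[set x : G | x *+ 4 == 0%R]| = 2
  ^ k)%N.
move: #|_| iU => m iU; move: #|_| => t h1 h2 h3.
(* Odd order would mean k = 0, leaving no room for a pair of distinct class members, although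
   [m >= 2]. *)
have /even_card : (2 %| #|G|)%N.
  apply: dvdn_trans kg; rewrite (@dvdn_exp2l 2 1) //; case: k {hk} h1 => // h1.
  have l0 : (0 < 2 ^ l)%N by rewrite expn_gt0.
  have t0 : t = 0%N by lia.
  by exfalso; move: h3; rewrite t0 add0n; nia.
case/(_ _ _ pk cv) => p hp.
have tE : t = (m * m - m)%N by rewrite -h3 addnK.
by apply: (@torsion_bounds_absurd n #|G| m k l p); rewrite -?tE.
Qed.

(** * Four generators *)

Section Search.
Local Open Scope nat_scope.

(* [(i, a)] stands for [a] times the [i]-th generator; zero is always [(0, 0)]. *)
Definition codes m : seq (nat * nat) := (0, 0) :: [seq (i, a) | i <- iota 0 m, a <- [:: 1; 2; 3]].
(** Selects one order of each independent pair: zero comes first, and nonzero codes go by increasing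
    generator index. *)
Definition before (x y : nat * nat) := (x.2 == 0) || (0 < y.2) && (x.1 < y.1).
Definition code_pairs m := [seq p <- [seq (x, y) | x <- codes m, y <- codes m] | before p.1 p.2].
Definition code_val (ks : seq nat) (x : nat * nat) := x.2 * nth 0 ks x.1.
Definition distinct_sums N (ks : seq nat) :=
  uniq [seq (code_val ks p.1 + code_val ks p.2) %% N | p <- code_pairs (size ks)].

Definition two67 := [seq x <- iota 0 67 | distinct_sums 67 [:: 1; x]].
Definition three67 := [seq p <- [seq (x, y) | x <- two67, y <- two67] | distinct_sums 67 [:: 1;
  p.1; p.2]].

Lemma mem_two67 x : x < 67 -> distinct_sums 67 [:: 1; x] -> x \in two67.
Proof. by move=> x67 d; rewrite mem_filter mem_iota d x67. Qed.

Lemma mem_three67 x y : x \in two67 -> y \in two67 -> distinct_sums 67 [:: 1; x; y] ->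
  (x, y) \in three67.
Proof. by move=> hx hy d; rewrite mem_filter d; apply: allpairs_f. Qed.

(** Any four packing generators 1, x, y, z have all their sub-triples through 1 in [three67], so the
    full test runs only on such candidates. *)
Lemma no_four67 : all (fun p => all (fun z => if (p.1, z) \in three67 then
   (if (p.2, z) \in three67 then ~~ distinct_sums 67 [:: 1; p.1; p.2;
     z] else true) else true) two67) three67.
Proof. by vm_cast_no_check (erefl true). Qed.

Lemma codesP m x : x \in codes m -> x = (0, 0) \/ (x.1 < m /\ 0 < x.2 <= 3).
Proof.
rewrite inE => /orP[/eqP|/allpairsP[[i a] [/= hi ha ->]]]; [by left|right].
by move: hi ha; rewrite mem_iota !inE => /andP[_ ->] /or3P[] /eqP->.
Qed.

Lemma code_pairsP m p : p \in code_pairs m ->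
  [/\ p.1 \in codes m, p.2 \in codes m & before p.1 p.2].
Proof. by rewrite mem_filter => /andP[bp /allpairsP[[x y] [hx hy pE]]]; rewrite pE in bp *. Qed.

End Search.

(** * From packing in a cyclic group to distinct sums modulo N *)

Section Cyclic.
Variables (G : finZmodType) (n N : nat) (s : 'I_n -> G) (g : G) (i0 : 'I_n).
Hypothesis pk : packs s.
Hypothesis gN : forall u v : nat, (u = v %[mod N])%N -> g *+ u = g *+ v.

Let dec (idx : seq 'I_n) (x : nat * nat) : axis_pt n :=
  if x.2 is a.+1 then Some (nth i0 idx x.1, inord a) else None.

Lemma packs_distinct_sums (idx : seq 'I_n) (ks : seq nat) : uniq idx -> size idx = size ks ->
  (forall i, (i < size ks)%N -> s (nth i0 idx i) = g *+ nth 0%N ks i) -> distinct_sums N ks.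
Proof.
move=> ui si hs; set m := size ks.
have dinj : {in codes m &, injective (dec idx)}.
  move=> [i a] [j b] /codesP [[-> ->]|[/= im a3]] /codesP[[-> ->]|[/= jm b3]] //; rewrite /dec /=.
  - by case: b b3.
  - by case: a a3.
  case: a b a3 b3 => // a [|b] // a3 b3 [] /eqP; rewrite nth_uniq ?si // => /eqP-> /(congr1 val)
    /=.
  by rewrite !inordK // => ->.
have dpt x : x \in codes m -> pt s (dec idx x) = g *+ code_val ks x.
  case/codesP => [->//|]; case: x => i [|a] //= [im a3].
  by rewrite /code_val /= inordK // hs // -mulrnA mulnC.
have dindep x y : x \in codes m -> y \in codes m -> before x y -> indep (dec idx x) (dec idx y).
  move=> /codesP [->|[xm x3]] /codesP[->|[ym y3]] //.
    by rewrite /before /= orbF => /eqP x0; rewrite x0 in x3.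
  case: x y xm x3 ym y3 => i [|a] [j [|b]] //= im _ jm _; rewrite /before /indep /dec /= => ij.
  by rewrite (inj_eq Some_inj) nth_uniq ?si // neq_ltn ij.
have ucodes : uniq (codes m).
  rewrite /codes cons_uniq allpairs_uniq ?iota_uniq // ?andbT;
    last by move=> [? ?] [? ?] _ _ [-> ->].
  by apply/allpairsP => -[[i a] [_ /= ]]; rewrite !inE => h [_ ea]; rewrite -ea in h.
rewrite /distinct_sums map_inj_in_uniq.
  by rewrite filter_uniq // allpairs_uniq // => -[? ?] [? ?] _ _ [-> ->].
move=> [x y] [x' y'] /code_pairsP[hx hy bxy] /code_pairsP[hx' hy' bxy'] /gN e.
rewrite !mulrnDr -!dpt // in e.
case: (pk (dindep _ _ hx hy bxy) (dindep _ _ hx' hy' bxy') e) => -[/dinj e1 /dinj e2].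
  by rewrite (e1 hx hx') (e2 hy hy').
(* The swapped case: [before] holds in both directions only when both codes are zero. *)
have {}e1 := e1 hx hy'; have {}e2 := e2 hy hx'; rewrite /= in hx hy e1 e2; subst x' y'.
move: bxy bxy' hx hy; rewrite /before /= => h1 h2 /codesP[xE|[_ h3]] /codesP[yE|[_ h4]].
- by rewrite xE yE.
- by move: h2; rewrite xE /= orbF => /eqP y0; rewrite y0 in h4.
- by move: h1; rewrite yE /= orbF => /eqP x0; rewrite x0 in h3.
- exfalso; move: h1 h2 h3 h4; clear.
  by move: (x.1 : nat) (x.2 : nat) (y.1 : nat) (y.2 : nat) => i a j b; lia.
Qed.

End Cyclic.

(** As 67 is prime, the nonzero [s_0] generates the group; measured in multiples of it, the first
    generator is 1 and the search applies. *)
Lemma card67_no_packs (G : finZmodType) (s : 'I_4 -> G) : #|G| = 67%N -> ~ packs s.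
Proof.
move=> G67 pk.
pose i0 : 'I_4 := ord0; pose g := s i0.
have g0 : g != 0.
  apply/eqP => g0; have lt03 : (0 < 3)%N by [].
  by have := @pt_inj _ _ _ pk (Some (i0, Ordinal lt03)) None;
    rewrite /= -/g g0 mul0rn => /(_ erefl).
have og : #[g]%g = 67%N.
  have := order_card g; rewrite G67 => /(prime_nt_dvdP (isT : prime 67)); apply.
  by apply: contra g0 => /eqP e; rewrite -[g]mulr1n -order_dvd e.
have gN (u v : nat) : (u = v %[mod 67])%N -> g *+ u = g *+ v.
  by move=> e; rewrite -!FinRing.zmodXgE -(expg_mod_order g u) -(expg_mod_order g v) og e.
have log (x : G) : exists2 k, (k < 67)%N & x = g *+ k.
  have : x \in <[g]>%g.
    suff -> : <[g]>%g = [set: G] by rewrite inE.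
    by apply/eqP; rewrite eqEcard finset.subsetT cardsT G67 -[#|_|]/#[g]%g og.
  case/cycleP => k ->; exists (k %% 67)%N; first by rewrite ltn_mod.
  by rewrite FinRing.zmodXgE; apply: gN; rewrite modn_mod.
have {log} [k kP] : exists k : 'I_4 -> nat, forall i, (k i < 67)%N /\ s i = g *+ k i.
  have {}log i : exists k, (k < 67)%N && (s i == g *+ k).
    by have [k k67 e] := log (s i); exists k; rewrite k67 e eqxx.
  by exists (fun i => xchoose (log i)) => i; have /andP[? /eqP] := xchooseP (log i).
have sums (idx : seq 'I_4) : uniq (i0 :: idx) -> distinct_sums 67 (1%N :: [seq k i | i <- idx]).
  move=> ui; apply: (packs_distinct_sums (i0 := i0) pk gN ui); first by rewrite /= size_map.
  case=> [|i] /= hi; first by rewrite mulr1n.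
  by rewrite size_map in hi; rewrite (nth_map i0) // -(kP _).2.
pose i1 : 'I_4 := @Ordinal 4 1 isT; pose i2 : 'I_4 := @Ordinal 4 2 isT; pose i3 : 'I_4 :=
  @Ordinal 4 3 isT.
have two i : i0 != i -> k i \in two67.
  by move=> hi; apply: mem_two67 (kP i).1 _; apply: (sums [:: i]); rewrite /= inE hi.
have three i j : uniq [:: i0; i; j] -> (k i, k j) \in three67.
  move=> u; apply: mem_three67; last exact: (sums [:: i; j]).
    by apply: two; move: u; rewrite /= !inE; case: eqP.
  by apply: two; move: u; rewrite /= !inE !negb_or -!andbA => /and3P[].
have := allP (allP no_four67 _ (three i1 i2 isT)) _ (two i3 isT).
by rewrite (three i1 i3 isT) (three i2 i3 isT) (sums [:: i1; i2; i3] isT).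
Qed.

Lemma packs_covers_le3 (G : finZmodType) (n : nat) (s : 'I_n -> G) :
  packs s -> covers s -> (n <= 3)%N.
Proof.
move=> pk cv; have := packs_covers_le4 pk cv; rewrite leq_eqVlt ltnS => /orP[/eqP n4|//].
have cG := card_group pk cv; exfalso.
subst n; apply: (@card67_no_packs G s _ pk); move: cG; move: #|_| => g; lia.
Qed.

(** * Lattice tilings *)

From mathcomp Require Import boolp classical_sets.

Section Vectors.
Variable n : nat.

Definition unit_vec (i : 'I_n) : 'rV[int]_n := delta_mx 0 i.
Notation vec := (pt unit_vec).

Lemma vecE x j : vec x 0 j = if x is Some (i, a) then (if j == i then a.+1%:Z else 0) else 0.
Proof.
case: x => [[i a]|] /=; last by rewrite mxE.
rewrite mulmxnE mxE eqxx /=; case: (j == i) => /=; last by rewrite mul0rn.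
by rewrite -mulrnA mul1n natz.
Qed.

(** The coordinates of a sum thus reveal which nonzero axis points occur in it, which yields packing
    for the unit vectors. *)
Lemma vec_coord x y (i : 'I_n) (a : 'I_3) : indep x y ->
  ((vec x + vec y : 'rV[int]_n) ord0 i == a.+1%:Z) = (x == Some (i, a)) || (y == Some (i, a)) .
Proof.
have E (b : 'I_3) : (b.+1%:Z == a.+1%:Z :> int) = (b == a) by rewrite eqz_nat eqSS.
rewrite mxE !vecE; case: x y => [[j b]|] [[k c]|] //=; rewrite /indep /= ?(inj_eq Some_inj)
  ?xpair_eqE => jk.
- rewrite ![i == _]eq_sym; case: (eqVneq j i) => [ji|ji] /=.
    by rewrite -ji [k == j]eq_sym (negPf jk) addr0 E orbF.
  by rewrite add0r; case: (k == i) => //=; rewrite E.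
- by rewrite addr0 [i == j]eq_sym orbF; case: (j == i) => //=; rewrite E.
- by rewrite add0r [i == k]eq_sym; case: (k == i) => //=; rewrite E.
Qed.

(** Coordinates cannot detect [None]; independence forbids a repeated nonzero point, so the nonzero
    members still fix the pair. *)
Lemma indep_match (x y x' y' : axis_pt n) : indep x y -> indep x' y' ->
  (forall u, u != None -> (u \in [:: x; y]) = (u \in [:: x'; y'])) ->
  (x, y) = (x', y') \/ (x, y) = (y', x').
Proof.
have K (x1 y1 x2 y2 : axis_pt n) : indep x1 y1 -> indep x2 y2 ->
    (forall u, u != None -> (u \in [:: x1; y1]) = (u \in [:: x2; y2])) -> x1 = x2 -> y1 = y2.
  move=> i1 i2 M e; subst x2; case: (eqVneq y1 None) => [y1N|y1N].
    apply/esym; subst y1; apply: contraTeq i2 => y2N.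
    have := M _ y2N; rewrite !inE eqxx orbT (negPf y2N) orbF => /eqP e.
    by rewrite e /indep eqxx orbF -e.
  have := M _ y1N; rewrite !inE eqxx orbT => /esym/orP[/eqP e|/eqP //].
  by move: i1; rewrite e /indep eqxx orbF -e (negPf y1N).
move=> i1 i2 M.
have i1' : indep y x by rewrite indep_sym.
have sw (u a b : axis_pt n) : (u \in [:: a; b]) = (u \in [:: b; a]) by rewrite !inE orbC.
have i2' : indep y' x' by rewrite indep_sym.
have Ml u : u != None -> (u \in [:: y; x]) = (u \in [:: x'; y']) by move/M <-; rewrite sw.
have Mr u : u != None -> (u \in [:: x; y]) = (u \in [:: y'; x']) by move/M ->; rewrite sw.
have Mlr u : u != None -> (u \in [:: y; x]) = (u \in [:: y'; x']) by move/Ml ->; rewrite sw.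
case: (eqVneq x None) => [xN|xN]; last first.
  have := M x xN; rewrite !inE eqxx => /esym/orP[] /eqP e; [left|right].
    by rewrite (K x y x' y' i1 i2 M e) e.
  by rewrite (K x y y' x' i1 i2' Mr e) e.
case: (eqVneq y None) => [yN|yN]; last first.
  have := M y yN; rewrite !inE eqxx orbT => /esym/orP[] /eqP e; [right|left].
    by rewrite (K y x x' y' i1' i2 Ml e) e.
  by rewrite (K y x y' x' i1' i2' Mlr e) e.
subst x y; left.
have N u : u \in [:: x'; y'] -> u = None.
  by move=> uM; apply/eqP; apply: contraT => /[dup] un /M; rewrite uM !inE orbb (negPf un).
have x'N : x' = None by apply: N; rewrite inE eqxx.
have y'N : y' = None by apply: N; rewrite !inE eqxx orbT.
by rewrite x'N y'N.
Qed.

Lemma vec_packs : packs unit_vec.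
Proof.
move=> x y x' y' xy xy' e; apply: indep_match => // -[[i a]|//] _.
by rewrite !inE ![Some (i, a) == _]eq_sym -!vec_coord ?e.
Qed.

Lemma error_ballP (v : 'rV[int]_n) : error_ball n 2 3 0 v <->
  exists x y : axis_pt n, indep x y /\ v = vec x + vec y.
Proof.
split=> [[v3 wv]|[x [y [xy ->]]]].
  pose cp (i : 'I_n) : axis_pt n := if v 0 i == 0 then None else Some (i, inord (absz (v 0
    i)).-1).
  have cpE i j : vec (cp i) 0 j = if j == i then v 0 i else 0.
    rewrite vecE /cp; case: eqP => [->|/eqP vi]; first by case: ifP.
    by case: eqP => // _; rewrite inordK; have := v3 i; lia.
  have [S0|[i vi]] : (forall i, v 0 i = 0) \/ exists i, v 0 i != 0.
    by case: (pselect (exists i, v 0 i != 0)) => [|h]; [right|left=> i; apply/eqP;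
      apply: contrapT => vi; case: h; exists i; apply/negP].
    by exists None, None; split=> //; apply/rowP => j; rewrite S0 !mxE addr0.
  have [S1|[j [ji vj]]] : (forall j, j != i -> v 0 j = 0) \/ exists j, j != i /\ v 0 j != 0.
    case: (pselect (exists j, j != i /\ v 0 j != 0)) => [|h]; [by right|left=> j ji].
    by apply/eqP; apply: contrapT => /negP vj; case: h; exists j.
    exists (cp i), None; split=> //; first by rewrite /indep /cp (negPf vi).
    apply/rowP => j; rewrite mxE cpE mxE addr0; case: eqP => [->//|/eqP ji]; exact: S1.
  exists (cp i), (cp j); split.
    by rewrite /indep /cp (negPf vi) (negPf vj) /= (inj_eq Some_inj) eq_sym.
  apply/rowP => k; rewrite mxE !cpE; case: eqP => [->|/eqP ki].
    by rewrite eq_sym (negPf ji) addr0.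
  (* A third nonzero coordinate would make the weight at least 3. *)
  rewrite add0r; case: eqP => [->//|/eqP kj]; apply/eqP; apply: contraT => vk.
  suff : (3 <= wt v)%N by move: wv; lia.
  have <- : #|[set i; j; k]%SET| = 3%N.
    by rewrite finset.setUC cardsU1 cards2 !inE negb_or ki kj [i == j]eq_sym ji.
  by apply/subset_leq_card/fintype.subsetP => l; rewrite !inE => /orP[/orP[]|] /eqP->.
split=> [i|].
  have bd (k : nat) : (k <= 3)%N -> - 0%:Z <= k%:Z <= 3%:Z by move=> k3; rewrite oppr0 lez_nat.
  rewrite mxE !vecE; move: xy.
  case: x y => [[j b]|] [[k c]|] //=; rewrite /indep /= ?(inj_eq Some_inj) ?addr0 ?add0r.
  - case: (eqVneq i j) => [->|_]; last by case: ifP => _ _; rewrite add0r;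
    [apply/bd/ltn_ord|apply: (bd 0%N)].
    by move=> /negPf->; rewrite addr0; apply/bd/ltn_ord.
  - by case: ifP => _ _; [apply/bd/ltn_ord|apply: (bd 0%N)].
  - by case: ifP => _ _; [apply/bd/ltn_ord|apply: (bd 0%N)].
have sub : {subset [pred i | (vec x + vec y) ord0 i != 0] <= pmap (@axis n) [:: x; y]}.
  move=> i; rewrite inE mxE !vecE.
  case: x y {xy} => [[j b]|] [[k c]|]; rewrite /= !inE ?addr0 ?add0r //;
    do ?case: (i == _) => //=.
apply: leq_trans (_ : #|pmap (@axis n) [:: x; y]| <= 2)%N.
  by apply/subset_leq_card/fintype.subsetP/sub.
by apply: leq_trans (card_size _) _; case: x y {xy sub} => [[? ?]|] [[? ?]|].
Qed.

End Vectors.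

(** Choosing a representing pair for each element embeds [V] into a finite type. *)
Lemma covers_finite (V : zmodType) n (s : 'I_n -> V) : packs s -> covers s ->
  exists (G : finZmodType) (t : 'I_n -> G), packs t /\ covers t.
Proof.
move=> pk cv.
have /choice[f fP] : forall g, exists p : axis_pt n * axis_pt n, pt s p.1 + pt s p.2 = g.
  by move=> g; have [x [y [_ ->]]] := cv g; exists (x, y).
have fK : cancel f (fun p => pt s p.1 + pt s p.2) by move=> g.
pose cnt := CanIsCountable fK; pose cV : countType := HB.pack (GRing.Zmodule.sort V)
  (GRing.Zmodule.class V) cnt.
pose fin := @CanIsFinite cV _ f _ fK.
pose G : finZmodType := HB.pack (GRing.Zmodule.sort V) (GRing.Zmodule.class V) cnt fin.
by exists G, s.
Qed.

(** [V] is the quotient by [C] and [s i] the class of the i-th unit vector; disjoint translates give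
    packing, and covering translates give covering. *)
Lemma lattice_tiling_quotient n (C : set 'rV[int]_n) : lattice_tiling (error_ball n 2 3 0) C ->
  exists (V : zmodType) (s : 'I_n -> V), packs s /\ covers s.
Proof.
case=> lat [cov triv _].
pose mix := GRing.isZmodClosed.Build _ [in C] lat.
pose I : zmodClosed 'rV[int]_n := HB.pack [in C] mix.
pose V : zmodType := ring_quotient.Quotient.quot I.
pose s i : V := \pi%qT (unit_vec i).
have ptE x : pt s x = \pi%qT (pt (@unit_vec n) x).
  by case: x => [[i a]|] /=; rewrite ?raddfMn ?raddf0.
have piD u v : \pi%qT u + \pi%qT v = \pi%qT (u + v) :> V by rewrite raddfD.
have piE u v : C (u - v) <-> \pi%qT u = \pi%qT v :> V.
  split=> [/mem_set h|/eqP h]; first by apply/eqP; rewrite -ring_quotient.Quotient.idealrBE.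
  by apply: set_mem; move: h; rewrite -ring_quotient.Quotient.idealrBE.
have C0 : C 0 by apply: set_mem; exact: lat.1.
exists V, s; split=> [x y x' y' xy xy'|g].
  pose u : 'rV[int]_n := pt (@unit_vec n) x + pt (@unit_vec n) y.
  pose u' : 'rV[int]_n := pt (@unit_vec n) x' + pt (@unit_vec n) y'.
  rewrite !ptE !piD -/u -/u' => /piE Cuu.
  (* Both 0 and [u - u'] lie in [C] and their translates share the point [u], so they are equal. *)
  apply: (vec_packs xy xy'); apply/eqP; rewrite -subr_eq0; apply/eqP/esym.
  apply: triv => //; exists u; split.
    by exists u; [apply/error_ballP; exists x, y | rewrite addr0].
  by exists u'; [apply/error_ballP; exists x', y' | rewrite addrC subrK].
elim/quotW: g => v.
have : cover C (translate (error_ball n 2 3 0)) v by rewrite cov.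
case=> c Cc [b /error_ballP[x [y [xy bE]]] bcv].
exists x, y; split=> //; rewrite !ptE piD -bE; apply/piE.
by rewrite -bcv addrAC subrr add0r.
Qed.

(** * The tiling in dimension three *)

Section Z37.
Local Open Scope nat_scope.

(** The coefficients 1, 10, 26 are the cube roots of unity modulo 37. *)
Definition residue37 (p : nat * nat * nat) := p.1.1 + 10 * p.1.2 + 26 * p.2.
(** In dimension 3, weight at most 2 means that some coordinate is 0; this leaves 64 - 27 = 37
    triples. *)
Definition ball3 : seq (nat * nat * nat) :=
  [seq p <- [seq (x, c) | x <- [seq (a, b) | a <- iota 0 4, b <- iota 0 4], c <- iota 0 4]
     | [|| p.1.1 == 0, p.1.2 == 0 | p.2 == 0]].

Lemma ball3P a b c : ((a, b, c) \in ball3) =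
  [&& a <= 3, b <= 3, c <= 3 & [|| a == 0, b == 0 | c == 0]].
Proof.
rewrite mem_filter /=; case: a b c => [|[|[|[|a]]]] [|[|[|[|b]]]] [|[|[|[|c]]]] //=.
all: rewrite ?andbF //.
Qed.

Lemma residue37_inj : {in ball3 &, forall p q, residue37 p = residue37 q %[mod 37] -> p = q}.
Proof.
have h : all (fun p => all (fun q => (residue37 p %% 37 == residue37 q %% 37) ==> (p == q))
  ball3) ball3.
  by vm_compute.
by move=> p q pB qB e; apply/eqP; move: (allP (allP h p pB) q qB); rewrite e eqxx.
Qed.

Lemma residue37_surj r : r < 37 -> exists2 p, p \in ball3 & residue37 p = r %[mod 37].
Proof.
have h : all (fun r => has (fun p => residue37 p %% 37 == r) ball3) (iota 0 37) by vm_compute.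
move=> r37; have /(allP h)/hasP[p pB /eqP e] : r \in iota 0 37 by rewrite mem_iota.
by exists p; rewrite // e modn_small.
Qed.

End Z37.

Definition lattice37 : set 'rV[int]_3 :=
  [set v : 'rV[int]_3 | (37 %| v ord0 (inord 0) + 10 * v ord0 (inord 1) + 26 * v ord0 (inord
    2))%Z].

Lemma lattice37_tiling : lattice_tiling (error_ball 3 2 3 0) lattice37.
Proof.
pose o (k : nat) : 'I_3 := inord k.
have ord3 (P : 'I_3 -> Prop) : P (o 0%N) -> P (o 1%N) -> P (o 2%N) -> forall i, P i.
  move=> P0 P1 P2 i; rewrite -[i]inord_val; case: i => -[|[|[|k]]] //.
pose f (v : 'rV[int]_3) := v ord0 (o 0%N) + 10 * v ord0 (o 1%N) + 26 * v ord0 (o 2%N).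
have fB u v : f (u - v) = f u - f v by rewrite /f !mxE; ring.
have CE v : lattice37 v = (37 %| f v)%Z by [].
pose tr (v : 'rV[int]_3) := (absz (v ord0 (o 0%N)), absz (v ord0 (o 1%N)), absz (v ord0 (o 2%N))).
pose vc (p : nat * nat * nat) : 'rV[int]_3 := \row_i (nth 0%N [:: p.1.1; p.1.2; p.2] i)%:Z.
have vc0 p : vc p ord0 (o 0%N) = p.1.1 by rewrite mxE /o inordK.
have vc1 p : vc p ord0 (o 1%N) = p.1.2 by rewrite mxE /o inordK.
have vc2 p : vc p ord0 (o 2%N) = p.2 by rewrite mxE /o inordK.
have fvc p : f (vc p) = residue37 p by rewrite /f vc0 vc1 vc2 /residue37; lia.
have ballE v : error_ball 3 2 3 0 v <-> exists2 p, p \in ball3 & v = vc p.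
  split=> [[v3 wv]|[[[a b] c] pB ->]].
    have v0 k : 0 <= v ord0 (o k) by have /andP[] := v3 (o k).
    have a3 k : (absz (v ord0 (o k)) <= 3)%N.
      by rewrite -lez_nat gez0_abs ?v0 //; have /andP[] := v3 (o k).
    exists (tr v); last by apply/rowP; apply: ord3; rewrite ?vc0 ?vc1 ?vc2 /tr /= gez0_abs.
    rewrite ball3P !a3 /=.
    rewrite !absz_eq0; apply: contraLR wv; rewrite !negb_or -ltnNge => /and3P[h0 h1 h2].
    rewrite /wt; have /eq_cardT-> : [pred i | v 0 i != 0] =i predT by move=> i; rewrite inE;
      move: i; apply: ord3.
    by rewrite -cardT card_ord.
  move: pB; rewrite ball3P => /and4P[a3 b3 c3 z]; split.
    by apply: ord3; rewrite ?vc0 ?vc1 ?vc2 /= ?oppr0 lez_nat.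
  have [k k0] : exists k, vc (a, b, c) ord0 k = 0.
    by case/or3P: z => /eqP e; [exists (o 0%N)|exists (o 1%N)|exists (o 2%N)];
      rewrite ?vc0 ?vc1 ?vc2 /= e.
  apply: leq_trans (_ : #|predC1 k| <= 2)%N; last by rewrite cardC1 card_ord.
  by apply/subset_leq_card/fintype.subsetP => i; rewrite !inE; apply: contra => /eqP->;
    rewrite k0.
have modE u v : (f u = f v %[mod 37])%Z <-> lattice37 (u - v).
  rewrite CE fB; split=> [/eqP|h]; first by rewrite eqz_mod_dvd.
  by apply/eqP; rewrite eqz_mod_dvd.
have vc_inj p q : p \in ball3 -> q \in ball3 -> lattice37 (vc p - vc q) -> p = q.
  move=> pB qB /modE; rewrite !fvc !modz_nat => -[e]; exact: residue37_inj.
have L0 : lattice37 0 by rewrite CE /f !mxE.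
have LB u v : lattice37 u -> lattice37 v -> lattice37 (u - v).
  by rewrite !CE fB; apply: rpredB.
split; [|split].
- split; first exact: mem_set.
  by move=> u v /set_mem hu /set_mem hv; apply/mem_set/LB.
- rewrite -subTset => v _.
  have r37 : (absz (f v %% 37)%Z < 37)%N by rewrite -ltz_nat gez0_abs ?modz_ge0 // ltz_pmod.
  have [p pB pr] := residue37_surj r37.
  exists (v - vc p); last by exists (vc p); [apply/ballE; exists p | rewrite addrC subrK].
  by apply/modE; rewrite fvc modz_nat pr -modz_nat gez0_abs ?modz_ge0 // modz_mod.
- move=> c c' Lc Lc' [_ [[b /ballE[p pB ->] <-] [b' /ballE[q qB ->] e]]].
  have pq : p = q.
    (* A common point [vc q + c' = vc p + c] puts the difference of the two ball elements in the
       lattice. *)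
    apply: vc_inj => //; have -> : vc p - vc q = c' - c by apply: (addIr (vc q + c));
      rewrite addrA subrK -e addrCA subrK.
    exact: LB.
  by move: e; rewrite pq => /addrI.
- move=> c _; exists (0 + c), 0 => //; apply/ballE; exists (0, 0, 0)%N; first by rewrite ball3P.
  by apply/rowP; apply: ord3; rewrite ?vc0 ?vc1 ?vc2 mxE.
Qed.

Theorem theorem1p1 (n : nat) (hn : (3 <= n)%N) :
  (exists C : set 'rV[int]_n, lattice_tiling (error_ball n 2 3 0) C) <-> n = 3%N.
Proof.
split=> [[C /lattice_tiling_quotient[V [s [pkV cvV]]]]|->]; last by exists lattice37;
  apply: lattice37_tiling.
have [G [t [pk cv]]] := covers_finite pkV cvV.
by apply/eqP; rewrite eqn_leq hn (packs_covers_le3 pk cv).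
Qed.
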